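(* Let $I\subseteq\mathbb{R}$ be an open interval and let $\sigma:I\to\mathbb{R}^3$ be a curve parametrized by arc length $s$, with curvature $\kappa_\sigma(s)>0$ and torsion $\tau_\sigma(s)\neq0$ for all $s\in I$, where $\kappa_\sigma$ and $\tau_\sigma$ are differentiable functions. Then $\sigma$ is congruent to a whirl curve and to a rectifying curve if and only if there exist real constants $\lambda\neq0$, $a\neq0$ and $b$, with either $as+b>0$ for all $s\in I$ or $as+b<0$ for all $s\in I$, such that, up to a rigid motion of $\mathbb{R}^3$, $\sigma(s)=(x(s),y(s),z(s))$ with $$x(s)=\frac{b+as}{a}\,\frac{\lambda}{\sqrt{1+\lambda^2}}\cos\!\left[\frac{1}{\lambda}\operatorname{arctanh}\!\left(\sqrt{\frac{1+\lambda^2}{1+(b+as)^2+\lambda^2}}\right)\right],$$ $$y(s)=-\frac{b+as}{a}\,\frac{\lambda}{\sqrt{1+\lambda^2}}\sin\!\left[\frac{1}{\lambda}\operatorname{arctanh}\!\left(\sqrt{\frac{1+\lambda^2}{1+(b+as)^2+\lambda^2}}\right)\right],$$ $$z(s)=\frac{1}{a}\,\frac{\sqrt{1+(b+as)^2+\lambda^2}}{\sqrt{1+\lambda^2}}.$$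
   Context: For a unit speed curve with positive curvature, $\{\mathbf{t},\mathbf{n},\mathbf{b}\}$ denotes its Frenet frame (tangent, normal, binormal), with Frenet equations $\mathbf{t}'=\kappa\mathbf{n}$, $\mathbf{n}'=-\kappa\mathbf{t}+\tau\mathbf{b}$, $\mathbf{b}'=-\tau\mathbf{n}$ (the curve is assumed smooth enough for the frame and these equations to exist). A whirl curve is a curve with curvature $\kappa>0$ and nowhere vanishing torsion $\tau$ such that there exist a constant unit vector $\mathbf{d}\in\mathbb{R}^3$ and a real constant $\lambda\neq0$ with $\langle\mathbf{n}(s),\mathbf{d}\rangle=\lambda\langle\mathbf{t}(s),\mathbf{d}\rangle$ for all $s$. A rectifying curve is a unit speed curve whose position vector always lies in its rectifying plane (the plane through the origin spanned by $\mathbf{t}(s)$ and $\mathbf{b}(s)$), i.e. $\langle\sigma(s),\mathbf{n}(s)\rangle=0$ for all $s$. Two curves are congruent if one is the image of the other under a rigid motion (orientation-preserving isometry) of $\mathbb{R}^3$. *)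

(* Defs.v *)
From mathcomp Require Import all_boot all_order all_algebra.
From mathcomp Require Import all_classical all_reals all_analysis.

Set Implicit Arguments.
Unset Strict Implicit.
Unset Printing Implicit Defensive.

Import Order.TTheory GRing.Theory Num.Theory.
Import numFieldNormedType.Exports.

Local Open Scope classical_set_scope.
Local Open Scope ring_scope.

Section EuclideanSpace.
Context {R : realType}.

Definition row3 (x y z : R) : 'rV[R]_3 := \row_j [:: x; y; z]`_j.

Definition dotv (u v : 'rV[R]_3) : R := (u *m v^T) 0 0.

(* The library norm of 'rV[R]_3 is the sup norm; this is the Euclidean one. *)
Definition enorm (u : 'rV[R]_3) : R := Num.sqrt (dotv u u).

Definition crossv (u v : 'rV[R]_3) : 'rV[R]_3 :=
  row3 (u 0 1 * v 0 2 - u 0 2 * v 0 1)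
       (u 0 2 * v 0 0 - u 0 0 * v 0 2)
       (u 0 0 * v 0 1 - u 0 1 * v 0 0).

Definition rigid_motion (f : 'rV[R]_3 -> 'rV[R]_3) : Prop :=
  exists (A : 'M[R]_3) (v : 'rV[R]_3),
    [/\ A *m A^T = 1%:M, \det A = 1 & forall p, f p = p *m A + v].

End EuclideanSpace.

(* A curve is a total function R -> 'rV[R]_3 of which only the values on the
   open interval I are relevant; derivatives at points of the open set I depend
   only on these values. *)
Section Curves.
Context {R : realType}.
Implicit Types (I : set R) (g : R -> 'rV[R]_3) (s : R).

Definition tangent g s : 'rV[R]_3 := derive1n 1 g s.
Definition curvature g s : R := enorm (derive1n 2 g s).
Definition normal g s : 'rV[R]_3 := (curvature g s)^-1 *: derive1n 2 g s.
Definition binormal g s : 'rV[R]_3 := crossv (tangent g s) (normal g s).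
(* sign convention of b' = - tau n *)
Definition torsion g s : R := - dotv (derive1 (binormal g) s) (normal g s).

(* Three-fold differentiability is what the Frenet equations for
   unit speed curves with positive curvature require. *)
Definition frenet_curve I g : Prop :=
  [/\ forall k s, (k < 3)%N -> I s -> derivable (derive1n k g) s 1,
      forall s, I s -> enorm (tangent g s) = 1
    & forall s, I s -> 0 < curvature g s].

Definition whirl_curve I g : Prop :=
  [/\ frenet_curve I g,
      forall s, I s -> torsion g s != 0
    & exists (d : 'rV[R]_3) (lambda : R),
        [/\ enorm d = 1, lambda != 0
          & forall s, I s ->
              dotv (normal g s) d = lambda * dotv (tangent g s) d]].

Definition rectifying_curve I g : Prop :=
  frenet_curve I g /\ forall s, I s -> dotv (g s) (normal g s) = 0.

Definition congruent I g h : Prop :=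
  exists2 f, rigid_motion f & forall s, I s -> f (g s) = h s.

Definition arctanh (x : R) : R := ln ((1 + x) / (1 - x)) / 2.

End Curves.

(* Main.v *)
Require Import Defs.
From mathcomp Require Import all_boot all_order all_algebra.
From mathcomp Require Import all_classical all_reals all_analysis.
From mathcomp Require Import ring lra.

(* Put w = a s + b, m = sqrt (1 + lambda^2) and W = sqrt (m^2 + w^2).
   For a rectifying curve <sigma, t> = w / a, <sigma, b> = 1 / a and
   tau = w kappa.  If moreover <n, d> = lambda <t, d>, the Frenet equations and
   |d| = 1 give kappa = a m^2 / (lambda w W^2) and, replacing d by -d if needed,
   <t, d> = w / (m W) and <b, d> = m / W.  The unit vector
   u = (lambda t - n) / m is orthogonal to d, and its derivative is
   (kappa W / m) (d x u), where kappa W / m is minus the derivative of the angle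
   theta of the statement.  So u rotated by theta about d is a constant vector
   e, and (e, d x e, d) are the coordinate axes sought.
   Conversely the explicit curve satisfies |gamma|^2 = (1 + w^2) / a^2, which
   makes it rectifying, and its third coordinate W / (a m) determines <t, e_3>
   and then <n, e_3> = +- lambda <t, e_3>, with a sign that is constant because
   w does not vanish. *)

Set Implicit Arguments.
Unset Strict Implicit.
Unset Printing Implicit Defensive.

Import Order.TTheory GRing.Theory Num.Theory.
Import numFieldNormedType.Exports.

Local Open Scope classical_set_scope.
Local Open Scope ring_scope.

(** * Vectors and orthonormal frames *)

Section VectorAlgebra.
Context {R : realType}.
Implicit Types u v w t n d x : 'rV[R]_3.

Lemma eq_rV3 u v :
  u 0 0 = v 0 0 -> u 0 1 = v 0 1 -> u 0 2 = v 0 2 -> u = v.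
Proof.
move=> e0 e1 e2; apply/rowP => -[[|[|[|//]]] lt_i].
- by rewrite (_ : Ordinal _ = 0) //; apply: val_inj.
- by rewrite (_ : Ordinal _ = 1) //; apply: val_inj.
- by rewrite (_ : Ordinal _ = 2) //; apply: val_inj.
Qed.

Lemma row3E (x y z : R) :
  (row3 x y z 0 0 = x) * (row3 x y z 0 1 = y) * (row3 x y z 0 2 = z).
Proof. by rewrite !mxE. Qed.

Lemma dotvE u v : dotv u v = u 0 0 * v 0 0 + u 0 1 * v 0 1 + u 0 2 * v 0 2.
Proof.
rewrite /dotv mxE !big_ord_recl big_ord0 addr0 !mxE addrA.
by do ?[congr (_ + _)]; congr (u _ _ * v _ _); apply: val_inj.
Qed.

Lemma dotvC u v : dotv u v = dotv v u.
Proof. by rewrite !dotvE; ring. Qed.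

Lemma dotvDl u v w : dotv (u + v) w = dotv u w + dotv v w.
Proof. by rewrite /dotv mulmxDl mxE. Qed.

Lemma dotvZl c u v : dotv (c *: u) v = c * dotv u v.
Proof. by rewrite /dotv -scalemxAl mxE. Qed.

Lemma dotvNl u v : dotv (- u) v = - dotv u v.
Proof. by rewrite -scaleN1r dotvZl mulN1r. Qed.

Lemma dotvDr u v w : dotv u (v + w) = dotv u v + dotv u w.
Proof. by rewrite !(dotvC u) dotvDl. Qed.

Lemma dotvZr c u v : dotv u (c *: v) = c * dotv u v.
Proof. by rewrite !(dotvC u) dotvZl. Qed.

Lemma dotvNr u v : dotv u (- v) = - dotv u v.
Proof. by rewrite !(dotvC u) dotvNl. Qed.

Lemma dotv0r u : dotv u 0 = 0.
Proof. by rewrite -(scale0r u) dotvZr mul0r. Qed.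

Definition dotv_lin := (dotvDl, dotvDr, dotvNl, dotvNr, dotvZl, dotvZr).

Lemma dotv_mulmxl (A : 'M[R]_3) u v : dotv (u *m A) v = dotv u (v *m A^T).
Proof. by rewrite /dotv trmx_mul trmxK mulmxA. Qed.

Lemma dotv_ge0 u : 0 <= dotv u u.
Proof. by rewrite dotvE !addr_ge0 // -expr2 sqr_ge0. Qed.

Lemma enorm_sqr u : enorm u ^+ 2 = dotv u u.
Proof. by rewrite sqr_sqrtr // dotv_ge0. Qed.

Lemma enorm1P u : enorm u = 1 <-> dotv u u = 1.
Proof.
by split=> [h|h]; [rewrite -enorm_sqr h expr1n | rewrite /enorm h sqrtr1].
Qed.

Lemma dotv_orthogonal (A : 'M[R]_3) u v :
  A *m A^T = 1%:M -> dotv (u *m A) (v *m A) = dotv u v.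
Proof. by move=> AA; rewrite dotv_mulmxl -mulmxA AA mulmx1. Qed.

Lemma enorm_orthogonal (A : 'M[R]_3) u :
  A *m A^T = 1%:M -> enorm (u *m A) = enorm u.
Proof. by move=> AA; rewrite /enorm dotv_orthogonal. Qed.

Lemma crossvDl u v w : crossv (u + v) w = crossv u w + crossv v w.
Proof. by apply: eq_rV3; rewrite /crossv !mxE /= ?mxE; ring. Qed.

Lemma crossvZl c u v : crossv (c *: u) v = c *: crossv u v.
Proof. by apply: eq_rV3; rewrite /crossv !mxE /= ?mxE; ring. Qed.

Lemma crossvC u v : crossv u v = - crossv v u.
Proof. by apply: eq_rV3; rewrite /crossv !mxE /= ?mxE; ring. Qed.

Lemma crossvDr u v w : crossv u (v + w) = crossv u v + crossv u w.
Proof. by rewrite crossvC crossvDl opprD -!(crossvC u). Qed.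

Lemma crossvZr c u v : crossv u (c *: v) = c *: crossv u v.
Proof. by rewrite crossvC crossvZl -scalerN -crossvC. Qed.

Lemma crossvNr u v : crossv u (- v) = - crossv u v.
Proof. by rewrite -scaleN1r crossvZr scaleN1r. Qed.

Lemma crossvv u : crossv u u = 0.
Proof. by apply: eq_rV3; rewrite /crossv row3E mxE; ring. Qed.

Lemma double_crossv u v w :
  crossv u (crossv v w) = dotv u w *: v - dotv u v *: w.
Proof.
by apply: eq_rV3; rewrite !dotvE /crossv !mxE /= ; ring.
Qed.

Lemma dotv_triple u v w : dotv (crossv u v) w = - dotv v (crossv u w).
Proof. by rewrite !dotvE !row3E; ring. Qed.

Lemma dotv_crossvl u v : dotv (crossv u v) u = 0.
Proof. by rewrite dotvE !row3E; ring. Qed.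

Lemma dotv_crossvr u v : dotv (crossv u v) v = 0.
Proof. by rewrite dotvE !row3E; ring. Qed.

(** Lagrange's identity, the source of unit length for the vectors built below as cross products. *)
Lemma dotv_crossv2 u v :
  dotv (crossv u v) (crossv u v) = dotv u u * dotv v v - dotv u v ^+ 2.
Proof. by rewrite !dotvE !row3E; ring. Qed.

(** * Positively oriented orthonormal frames *)

Section Frame.
Variables t n : 'rV[R]_3.
Hypotheses (tt1 : dotv t t = 1) (nn1 : dotv n n = 1) (tn0 : dotv t n = 0).
Let b := crossv t n.

Definition frame_mx : 'M[R]_3 := \matrix_i [:: t; n; b]`_i.

(** The nine products form one tuple so that a single rewrite rule evaluates any inner product of
    frame vectors. *)
Lemma frame_dotv : (dotv t t = 1) * (dotv t n = 0) * (dotv t b = 0)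
  * (dotv n t = 0) * (dotv n n = 1) * (dotv n b = 0)
  * (dotv b t = 0) * (dotv b n = 0) * (dotv b b = 1).
Proof.
have nt0 : dotv n t = 0 by rewrite dotvC.
have bt0 : dotv b t = 0 by rewrite dotv_crossvl.
have bn0 : dotv b n = 0 by rewrite dotv_crossvr.
have bb1 : dotv b b = 1 by rewrite dotv_crossv2 tt1 nn1 tn0; ring.
by rewrite tt1 nn1 tn0 nt0 bt0 bn0 bb1 (dotvC t b) (dotvC n b) bt0 bn0.
Qed.

Lemma frame_crossv : (crossv t n = b) * (crossv n b = t) * (crossv b t = n)
  * (crossv n t = - b) * (crossv b n = - t) * (crossv t b = - n)
  * (crossv t t = 0) * (crossv n n = 0) * (crossv b b = 0).
Proof.
have nb : crossv n b = t.
  by rewrite double_crossv !frame_dotv scale1r scale0r subr0.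
have tb : crossv t b = - n.
  by rewrite double_crossv !frame_dotv scale1r scale0r sub0r.
rewrite nb tb !crossvv; do ![split] => //.
- by rewrite crossvC tb opprK.
- by rewrite crossvC.
- by rewrite crossvC nb.
Qed.

Lemma frame_mx_orthogonal : frame_mx *m frame_mx^T = 1%:M.
Proof.
have H i j :
    (frame_mx *m frame_mx^T) i j = dotv [:: t; n; b]`_i [:: t; n; b]`_j.
  rewrite /dotv !mxE; apply: eq_bigr => k _.
  by rewrite !mxE.
apply/matrixP => i j; rewrite H mxE.
by case: i j => -[|[|[|//]]] ? [[|[|[|//]]]] ? /=; rewrite !frame_dotv.
Qed.

Lemma mulmx_trframe x :
  x *m frame_mx^T = row3 (dotv x t) (dotv x n) (dotv x b).
Proof.
have H i : (x *m frame_mx^T) 0 i = dotv x [:: t; n; b]`_i.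
  by rewrite /dotv !mxE; apply: eq_bigr => k _; rewrite !mxE.
by apply: eq_rV3; rewrite H row3E.
Qed.

(** A one-sided inverse of a square matrix is two-sided, so [x] equals
    [x *m frame_mx^T *m frame_mx], and [mulmx_trframe] reads off the coefficients. *)
Lemma frame_expand x :
  x = dotv x t *: t + dotv x n *: n + dotv x b *: b.
Proof.
have := mulmx1C frame_mx_orthogonal => /(congr1 (mulmx x)).
rewrite mulmx1 mulmxA mulmx_trframe => {1}<-.
apply/rowP => j; rewrite !mxE !big_ord_recl big_ord0 !mxE /= addr0.
by rewrite addrA.
Qed.

Lemma frame_parseval x y :
  dotv x y = dotv x t * dotv y t + dotv x n * dotv y n + dotv x b * dotv y b.
Proof. by rewrite {1}(frame_expand y) !dotv_lin; ring. Qed.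

(** The entries of [b] are the signed minors of [t] and [n], so the expanded determinant is the
    polynomial [dotv b b]. *)
Lemma det_frame_mx : \det frame_mx = 1.
Proof.
(* Serves to turn the lifted ordinals created by the cofactors into plain indices. *)
have coordE (x : 'rV[R]_3) k : x 0 k = [:: x 0 0; x 0 1; x 0 2]`_k.
  by case: k => -[|[|[|//]]] ?; congr (x 0 _); apply: val_inj.
do 2! rewrite ?(expand_det_row _ 0) !big_ord_recl !big_ord0 /cofactor.
rewrite !det_mx11 !mxE /= ![t 0 (lift _ _)]coordE ![n 0 (lift _ _)]coordE.
rewrite [t 0 ord0]coordE /bump /= !addn0 !addn1.
have [_ bb1] := frame_dotv; rewrite -[RHS]bb1 dotvE !row3E add0n; ring.
Qed.
End Frame.

End VectorAlgebra.

(** * Derivatives *)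

Section Calculus.
Context {R : realType}.
Implicit Types (f g : R -> 'rV[R]_3) (c : R -> R) (s : R) (u v : 'rV[R]_3).

Lemma is_derive_rVP f s v :
  is_derive s 1 f v <-> forall j, is_derive s 1 (fun x => f x 0 j) (v 0 j).
Proof.
split=> [[df <-] j | df].
  have dfj := (derivable_mxP _ _ _).1 df 0 j.
  by apply: DeriveDef; rewrite // derive_mx // mxE.
have dfd : derivable f s 1.
  by apply/derivable_mxP => i j; rewrite (ord1 i); apply: ex_derive.
apply: DeriveDef => //; rewrite derive_mx //.
by apply/rowP => j; rewrite mxE; exact: derive_val.
Qed.

(* The eta-expanded forms of is_deriveM, is_deriveD etc. below compose as terms
   without unfolding products and sums of functions. *)
Lemma is_derive_mul c1 c2 s d1 d2 :
  is_derive s 1 c1 d1 -> is_derive s 1 c2 d2 ->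
  is_derive s 1 (fun x => c1 x * c2 x) (d1 * c2 s + c1 s * d2).
Proof.
move=> h1 h2; apply: (is_derive_eq (is_deriveM h1 h2)).
by rewrite /GRing.scale /= addrC (mulrC d1).
Qed.

Lemma is_derive_sqr c s d :
  is_derive s 1 c d -> is_derive s 1 (fun x => c x ^+ 2) (2 * c s * d).
Proof.
by move=> dc; apply: (is_derive_eq (is_derive_mul dc dc)); ring.
Qed.

Lemma is_derive_add c1 c2 s d1 d2 :
  is_derive s 1 c1 d1 -> is_derive s 1 c2 d2 ->
  is_derive s 1 (fun x => c1 x + c2 x) (d1 + d2).
Proof. by move=> h1 h2; exact: is_deriveD. Qed.

Lemma is_derive_opp c s d :
  is_derive s 1 c d -> is_derive s 1 (fun x => - c x) (- d).
Proof. by move=> h; exact: is_deriveN. Qed.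

Lemma is_derive_const (k s : R) : is_derive s 1 (fun=> k) 0.
Proof. exact: is_derive_cst. Qed.

Lemma is_derive_inv c s d : is_derive s 1 c d ->
  c s != 0 -> is_derive s 1 (fun x => (c x)^-1) (- d / c s ^+ 2).
Proof.
move=> h c0; apply: (is_derive_eq (is_deriveV c0 h)).
by rewrite /GRing.scale /= mulNr mulNr mulrC.
Qed.

Lemma is_derive_vconst u s : is_derive s 1 (fun=> u) 0.
Proof. exact: is_derive_cst. Qed.

Lemma is_derive_vadd f g s u v : is_derive s 1 f u -> is_derive s 1 g v ->
  is_derive s 1 (fun x => f x + g x) (u + v).
Proof. by move=> h1 h2; exact: is_deriveD. Qed.

Lemma is_derive_vopp f s u :
  is_derive s 1 f u -> is_derive s 1 (fun x => - f x) (- u).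
Proof. by move=> h; exact: is_deriveN. Qed.

Lemma is_derive_vscale c f s d u : is_derive s 1 c d -> is_derive s 1 f u ->
  is_derive s 1 (fun x => c x *: f x) (d *: f s + c s *: u).
Proof.
move=> hc /is_derive_rVP hf; apply/is_derive_rVP => j.
rewrite [X in is_derive _ _ X _](_ : _ = fun x => c x * f x 0 j).
  by rewrite !mxE; exact: is_derive_mul.
by apply/funext => x; rewrite mxE.
Qed.

Lemma is_derive_dotv f g s u v : is_derive s 1 f u -> is_derive s 1 g v ->
  is_derive s 1 (fun x => dotv (f x) (g x)) (dotv u (g s) + dotv (f s) v).
Proof.
move=> /is_derive_rVP hf /is_derive_rVP hg.
rewrite [X in is_derive _ _ X _](_ : _ = fun x => f x 0 0 * g x 0 0
   + f x 0 1 * g x 0 1 + f x 0 2 * g x 0 2); last first.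
  by apply/funext => x; rewrite dotvE.
apply: (is_derive_eq (is_derive_add (is_derive_add (is_derive_mul (hf 0) (hg 0))
  (is_derive_mul (hf 1) (hg 1))) (is_derive_mul (hf 2) (hg 2)))).
by rewrite !dotvE; ring.
Qed.

Lemma is_derive_crossv f g s u v : is_derive s 1 f u -> is_derive s 1 g v ->
  is_derive s 1 (fun x => crossv (f x) (g x)) (crossv u (g s) + crossv (f s) v).
Proof.
move=> /is_derive_rVP hf /is_derive_rVP hg; apply/is_derive_rVP => j.
have H i k : is_derive s 1 (fun x => f x 0 i * g x 0 k - f x 0 k * g x 0 i)
  (u 0 i * g s 0 k - u 0 k * g s 0 i + (f s 0 i * v 0 k - f s 0 k * v 0 i)).
  apply: (is_derive_eq (is_derive_add (is_derive_mul (hf i) (hg k))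
    (is_derive_opp (is_derive_mul (hf k) (hg i))))).
  by ring.
case: j => -[|[|[|//]]] lt_j; rewrite [X in is_derive _ _ X _](_ : _ = fun x =>
  [:: f x 0 1 * g x 0 2 - f x 0 2 * g x 0 1;
      f x 0 2 * g x 0 0 - f x 0 0 * g x 0 2;
      f x 0 0 * g x 0 1 - f x 0 1 * g x 0 0]`_(Ordinal lt_j)) //=;
  by [rewrite !mxE | apply/funext => x; rewrite mxE].
Qed.

Lemma is_derive_mulmx f s u (A : 'M[R]_3) v :
  is_derive s 1 f u -> is_derive s 1 (fun x => f x *m A + v) (u *m A).
Proof.
move=> hf; rewrite -[u *m A]addr0.
apply: (is_derive_vadd _ (is_derive_vconst v s)).
have mulE w j : (w *m A) 0 j = dotv w (row j A^T).
  by rewrite /dotv !mxE; apply: eq_bigr => k _; rewrite !mxE.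
apply/is_derive_rVP => j; rewrite mulE.
rewrite [X in is_derive _ _ X _](_ : _ = fun x => dotv (f x) (row j A^T)).
  apply: (is_derive_eq (is_derive_dotv hf (is_derive_vconst _ _))).
  by rewrite dotvE !mxE; rewrite dotvE !mxE; ring.
by apply/funext => x; rewrite mulE.
Qed.

Lemma is_derive_sqrt c s d : is_derive s 1 c d -> 0 < c s ->
  is_derive s 1 (fun x => Num.sqrt (c x)) (d / (2 * Num.sqrt (c s))).
Proof.
move=> h c0; apply: (is_derive_eq (is_derive1_comp (is_derive1_sqrt c0) h)).
by rewrite mulrC.
Qed.

Lemma is_derive_ln c s d : is_derive s 1 c d -> 0 < c s ->
  is_derive s 1 (fun x => ln (c x)) (d / c s).
Proof.
move=> h c0; apply: (is_derive_eq (is_derive1_comp (is_derive1_ln c0) h)).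
by rewrite mulrC.
Qed.

(** The bound on [c s] makes [1 + c s] and [1 - c s] positive, hence also the argument of the
    logarithm. *)
Lemma is_derive_arctanh c s d : is_derive s 1 c d -> `|c s| < 1 ->
  is_derive s 1 (fun x => arctanh (c x)) (d / (1 - c s ^+ 2)).
Proof.
move=> dc; rewrite ltr_norml => /andP[c1 c2].
have p0 : 0 < 1 + c s by lra.
have q0 : 0 < 1 - c s by lra.
have p0' := lt0r_neq0 p0; have q0' := lt0r_neq0 q0.
have dq := is_derive_inv (is_derive_add (is_derive_const 1 s)
  (is_derive_opp dc)) q0'.
have dp := is_derive_add (is_derive_const 1 s) dc.
have f0 : 0 < (1 + c s) / (1 - c s) by rewrite divr_gt0.
apply: (is_derive_eq (is_derive_mul (is_derive_ln (is_derive_mul dp dq) f0)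
  (is_derive_const 2^-1 s))).
have e0 : 1 - c s ^+ 2 != 0.
  by rewrite (_ : _ - _ = (1 - c s) * (1 + c s)) ?mulf_neq0 //; ring.
by field; rewrite e0 p0' q0'.
Qed.

Lemma is_derive_comp_cos c s d :
  is_derive s 1 c d -> is_derive s 1 (fun x => cos (c x)) (- (sin (c s) * d)).
Proof.
move=> h.
by apply: (is_derive_eq (is_derive1_comp (is_derive_cos _) h)); rewrite mulNr.
Qed.

Lemma is_derive_comp_sin c s d :
  is_derive s 1 c d -> is_derive s 1 (fun x => sin (c x)) (cos (c s) * d).
Proof. by move=> h; exact: (is_derive1_comp (is_derive_sin _) h). Qed.

Lemma is_derive_unique {V : normedModType R} {f : R -> V} {s} {u v : V} :
  is_derive s 1 f u -> is_derive s 1 f v -> u = v.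
Proof. by move=> [_ <-] [_ <-]. Qed.

(** Together with [is_derive_unique] this differentiates an identity known only on [I]: both sides
    have the same derivative at each point of the open set [I]. *)
Lemma is_derive_on {V : normedModType R} (I : set R) {f g : R -> V} {s}
    {u : V} :
  open I -> I s -> (forall x, I x -> f x = g x) ->
  is_derive s 1 f u -> is_derive s 1 g u.
Proof.
move=> I_open Is fg; apply: near_eq_is_derive.
by apply: filterS fg _; exact: open_nbhs_nbhs.
Qed.

Lemma derive1P {V : normedModType R} {f : R -> V} {s} :
  derivable f s 1 -> is_derive s 1 f (derive1 f s).
Proof. by move=> df; rewrite derive1E; exact: derivableP. Qed.

Lemma is_derive_derive1 {V : normedModType R} {f : R -> V} {s} {v : V} :
  is_derive s 1 f v -> derive1 f s = v.
Proof. by move=> [_ <-]; rewrite derive1E. Qed.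

(** Mean value theorem on the segment from [x] to [y], which stays inside the interval [I]. *)
Lemma is_derive0_cst_itv (I : set R) c x y : is_interval I ->
  (forall s, I s -> is_derive s 1 c 0) -> I x -> I y -> c x = c y.
Proof.
move=> I_itv dc; wlog xy : x y / x <= y.
  by move=> H Ix Iy; case: (leP x y) => [/H|/ltW /H h]; [exact | exact/esym/h].
move=> Ix Iy; have Ixy z : z \in `[x, y] -> I z.
  by rewrite in_itv /= => /andP[xz zy]; apply: (I_itv x y) => //; apply/andP.
have dcz z : z \in `]x, y[ -> is_derive z 1 c 0.
  by move=> zxy; apply/dc/Ixy; exact: subset_itv_oo_cc zxy.
have cc : {within `[x, y], continuous c}.
  apply: derivable_within_continuous => z /Ixy /dc dcz0.
  exact: (@ex_derive _ _ _ _ _ _ _ dcz0).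
have [z _] := MVT_segment xy dcz cc.
by rewrite mul0r => /eqP; rewrite subr_eq0 eq_sym => /eqP.
Qed.

Lemma is_derive0_vcst_itv (I : set R) f x y : is_interval I ->
  (forall s, I s -> is_derive s 1 f 0) -> I x -> I y -> f x = f y.
Proof.
move=> I_itv df Ix Iy; apply/rowP => j.
apply: (is_derive0_cst_itv (c := fun s => f s 0 j) I_itv) => // s /df.
by move/is_derive_rVP => /(_ j); rewrite mxE.
Qed.

End Calculus.

(** * Frenet equations and rigid motions *)

Section FrenetFrame.
Context {R : realType}.
Variables (I : set R) (g : R -> 'rV[R]_3).
Hypotheses (I_open : open I) (g_frenet : frenet_curve I g).
Implicit Types s : R.

Lemma is_derive_curve s : I s -> is_derive s 1 g (tangent g s).
Proof. by case: g_frenet => dg _ _ Is; apply: derive1P; exact: (dg 0 s). Qed.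

Lemma is_derive_tangent2 s : I s -> is_derive s 1 (tangent g) (derive1n 2 g s).
Proof. by case: g_frenet => dg _ _ Is; apply: derive1P; exact: (dg 1 s). Qed.

Lemma curvature_neq0 s : I s -> curvature g s != 0.
Proof. by case: g_frenet => _ _ k0 /k0; exact: lt0r_neq0. Qed.

Lemma is_derive_tangent s : I s ->
  is_derive s 1 (tangent g) (curvature g s *: normal g s).
Proof.
move=> Is; apply: (is_derive_eq (is_derive_tangent2 Is)).
by rewrite /normal scalerA mulfV ?scale1r ?curvature_neq0.
Qed.

Lemma dotv_tangent s : I s -> dotv (tangent g s) (tangent g s) = 1.
Proof. by case: g_frenet => _ t1 _ /t1; rewrite enorm1P. Qed.

Lemma dotv_normal s : I s -> dotv (normal g s) (normal g s) = 1.
Proof.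
move=> Is; rewrite /normal dotvZl dotvZr -enorm_sqr -/(curvature g s).
by have := curvature_neq0 Is => k0; field.
Qed.

(** Differentiating [dotv t t = 1] gives [2 * kappa * dotv t n = 0], and the curvature does not
    vanish. *)
Lemma dotv_tangent_normal s : I s -> dotv (tangent g s) (normal g s) = 0.
Proof.
move=> Is; have dt := is_derive_tangent Is.
have := is_derive_unique (is_derive_on I_open Is dotv_tangent
  (is_derive_dotv dt dt)) (is_derive_const 1 s).
rewrite dotvZl dotvZr (dotvC (normal g s)) => e.
have : (2 * curvature g s) * dotv (tangent g s) (normal g s) = 0.
  by rewrite -e; ring.
by move/eqP; rewrite !mulf_eq0 pnatr_eq0 (negPf (curvature_neq0 Is)) => /eqP.
Qed.

Section FrenetEquations.
Hypothesis curvature_diff : forall s, I s -> derivable (curvature g) s 1.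

Lemma derivable_normal s : I s -> derivable (normal g) s 1.
Proof.
move=> Is; have [dg _ _] := g_frenet.
have h := is_derive_vscale (is_derive_inv
  (derive1P (curvature_diff Is)) (curvature_neq0 Is))
  (derive1P (dg 2%N s erefl Is)).
exact: (@ex_derive _ _ _ _ _ _ _ h).
Qed.

(** A provisional form with [n'] unexpanded: it is what links the torsion, defined through [b'], to
    the component of [n'] along [b]. *)
Lemma is_derive_binormal1 s : I s -> is_derive s 1 (binormal g)
  (crossv (tangent g s) (derive1 (normal g) s)).
Proof.
move=> Is.
apply: (is_derive_eq (is_derive_crossv (is_derive_tangent Is)
  (derive1P (derivable_normal Is)))).
by rewrite crossvZl crossvv scaler0 add0r.
Qed.

(** The frame coefficients of [n'] come from differentiating [dotv n n = 1] and [dotv t n = 0], and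
    from the definition of the torsion. *)
Lemma is_derive_normal s : I s -> is_derive s 1 (normal g)
  (- curvature g s *: tangent g s + torsion g s *: binormal g s).
Proof.
move=> Is; set t := tangent g s; set n := normal g s; set b := binormal g s.
have tt : dotv t t = 1 by exact: dotv_tangent.
have nn : dotv n n = 1 by exact: dotv_normal.
have tn : dotv t n = 0 by exact: dotv_tangent_normal.
have dn := derive1P (derivable_normal Is).
apply: (is_derive_eq dn); rewrite [LHS](frame_expand tt nn tn).
have nn' : dotv (derive1 (normal g) s) n = 0.
  have := is_derive_unique (is_derive_on I_open Is dotv_normal
    (is_derive_dotv dn dn)) (is_derive_const 1 s).
  rewrite (dotvC (normal g s)) -mulr2n -/n => /eqP.
  by rewrite mulrn_eq0 => /eqP.
have tn' : dotv (derive1 (normal g) s) t = - curvature g s.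
  have := is_derive_unique (is_derive_on I_open Is dotv_tangent_normal
    (is_derive_dotv (is_derive_tangent Is) dn)) (is_derive_const 0 s).
  rewrite dotvZl -/n nn mulr1 (dotvC (tangent g s)) -/t addrC => /eqP.
  by rewrite addr_eq0 => /eqP.
have tb' : dotv (derive1 (normal g) s) b = torsion g s.
  rewrite /torsion (is_derive_derive1 (is_derive_binormal1 Is)).
  by rewrite dotv_triple opprK.
by rewrite -/b nn' tn' tb' scale0r addr0.
Qed.

Lemma is_derive_binormal s : I s ->
  is_derive s 1 (binormal g) (- torsion g s *: normal g s).
Proof.
move=> Is; apply: (is_derive_eq (is_derive_binormal1 Is)).
rewrite (is_derive_derive1 (is_derive_normal Is)).
have e := frame_crossv (dotv_tangent Is) (dotv_normal Is)
  (dotv_tangent_normal Is).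
by rewrite crossvDr !crossvZr !e scaler0 add0r scalerN [RHS]scaleNr.
Qed.
End FrenetEquations.
End FrenetFrame.

(** * Tangent, normal and curvature under a rigid motion *)

Section RigidMotion.
Context {R : realType}.
Variables (I : set R) (g h : R -> 'rV[R]_3) (A : 'M[R]_3) (v : 'rV[R]_3).
Hypotheses (I_open : open I) (g_frenet : frenet_curve I g).
Hypotheses (A_orthogonal : A *m A^T = 1%:M)
  (ghE : forall s, I s -> g s *m A + v = h s).
Implicit Types s : R.

Lemma is_derive_motion s : I s -> is_derive s 1 h (tangent g s *m A).
Proof.
move=> Is; apply: (is_derive_on I_open Is ghE).
by apply: is_derive_mulmx; exact: is_derive_curve g_frenet _ Is.
Qed.

Lemma tangent_motion s : I s -> tangent h s = tangent g s *m A.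
Proof. by move=> /is_derive_motion; exact: is_derive_derive1. Qed.

Lemma is_derive_tangent_motion s :
  I s -> is_derive s 1 (tangent h) (derive1n 2 g s *m A).
Proof.
(* Translations disappear from derivatives; the zero translation only matches the affine shape of
   [is_derive_mulmx]. *)
move=> Is; apply: (is_derive_on (f := fun s => tangent g s *m A + 0) I_open Is).
  by move=> x Ix; rewrite addr0 tangent_motion.
by apply: is_derive_mulmx; exact: is_derive_tangent2 g_frenet _ Is.
Qed.

Lemma derive2_motion s : I s -> derive1n 2 h s = derive1n 2 g s *m A.
Proof. by move=> /is_derive_tangent_motion; exact: is_derive_derive1. Qed.

Lemma curvature_motion s : I s -> curvature h s = curvature g s.
Proof. by move=> Is; rewrite /curvature derive2_motion // enorm_orthogonal. Qed.

Lemma normal_motion s : I s -> normal h s = normal g s *m A.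
Proof.
by move=> Is; rewrite /normal curvature_motion // derive2_motion // scalemxAl.
Qed.

Lemma frenet_motion : frenet_curve I h.
Proof.
split=> [k s k3 Is | s Is | s Is].
- case: k k3 => [|[|[|//]]] _.
  + exact: (@ex_derive _ _ _ _ _ _ _ (is_derive_motion Is)).
  + exact: (@ex_derive _ _ _ _ _ _ _ (is_derive_tangent_motion Is)).
  have [dg _ _] := g_frenet.
  have h3 : is_derive s 1 (derive1n 2 h) (derive1 (derive1n 2 g) s *m A).
    apply: (is_derive_on (f := fun s => derive1n 2 g s *m A + 0) I_open Is).
      by move=> x Ix; rewrite addr0 derive2_motion.
    by apply: is_derive_mulmx; apply: derive1P; exact: (dg 2%N).
  exact: (@ex_derive _ _ _ _ _ _ _ h3).
- by rewrite tangent_motion // enorm_orthogonal //; case: g_frenet => _ ->.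
- by rewrite curvature_motion //; case: g_frenet => _ _ ->.
Qed.
End RigidMotion.

(** * Curves that are both whirl and rectifying *)

Section CanonicalCurve.
Context {R : realType}.
Variables (a b l : R).
Hypothesis l0 : l != 0.
Implicit Types s : R.

Definition lin_w s := b + a * s.
Definition root_W s := Num.sqrt (1 + lin_w s ^+ 2 + l ^+ 2).
Definition root_m := Num.sqrt (1 + l ^+ 2).
(** The quotient stays under one square root, as in the closed form to be reached; [angleE] gives
    the form used for computing. *)
Definition angle s := l^-1 * arctanh (Num.sqrt
  ((1 + l ^+ 2) / (1 + lin_w s ^+ 2 + l ^+ 2))).

Lemma root_m_gt0 : 0 < root_m.
Proof. by rewrite sqrtr_gt0 ltr_wpDr ?sqr_ge0. Qed.

Lemma root_m2 : root_m ^+ 2 = 1 + l ^+ 2.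
Proof. by rewrite sqr_sqrtr // addr_ge0 ?sqr_ge0. Qed.

Lemma root_W_gt0 s : 0 < root_W s.
Proof. by rewrite sqrtr_gt0 -addrA ltr_wpDr // addr_ge0 ?sqr_ge0. Qed.

Lemma root_W2 s : root_W s ^+ 2 = 1 + lin_w s ^+ 2 + l ^+ 2.
Proof. by rewrite sqr_sqrtr // !addr_ge0 ?sqr_ge0. Qed.

Lemma is_derive_lin_w s : is_derive s 1 lin_w a.
Proof.
apply: (is_derive_eq (is_derive_add (is_derive_const b s)
  (is_derive_mul (is_derive_const a s) (is_derive_id s 1)))).
by rewrite mulr1 mul0r !add0r.
Qed.

Lemma is_derive_root_W s : is_derive s 1 root_W (lin_w s * a / root_W s).
Proof.
have W0 := lt0r_neq0 (root_W_gt0 s).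
have dw := is_derive_lin_w s.
have c0 : 0 < 1 + lin_w s ^+ 2 + l ^+ 2.
  by rewrite -addrA ltr_wpDr // addr_ge0 ?sqr_ge0.
apply: (is_derive_eq (is_derive_sqrt (is_derive_add (is_derive_add
  (is_derive_const 1 s) (is_derive_sqr dw)) (is_derive_const (l ^+ 2) s)) c0)).
by rewrite add0r addr0 -/(root_W s); field.
Qed.

Lemma angleE s : angle s = l^-1 * arctanh (root_m / root_W s).
Proof.
by rewrite /angle sqrtrM ?sqrtrV // ?addr_ge0 ?sqr_ge0.
Qed.

(** Since [W ^+ 2 = m ^+ 2 + w ^+ 2], a nonzero [w] keeps [m / W] below 1, and [1 - (m / W) ^+ 2] is
    the square of [w / W]. *)
Lemma is_derive_angle s : lin_w s != 0 ->
  is_derive s 1 angle (- (root_m * a) / (l * root_W s * lin_w s)).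
Proof.
move=> w0; have W0 := lt0r_neq0 (root_W_gt0 s).
have W2 := root_W2 s; have m2 := root_m2; have m0 := root_m_gt0.
rewrite (_ : angle = fun s => l^-1 * arctanh (root_m / root_W s)); last first.
  by apply/funext => x; exact: angleE.
have dc := is_derive_mul (is_derive_const root_m s)
  (is_derive_inv (is_derive_root_W s) W0).
have c1 : `|root_m / root_W s| < 1.
  rewrite ger0_norm ?divr_ge0 ?ltW ?root_W_gt0 //.
  rewrite ltr_pdivrMr ?root_W_gt0 // mul1r.
  rewrite -(ltr_pXn2r (_ : 0 < 2)%N) ?nnegrE ?ltW ?root_W_gt0 // m2 W2.
  by rewrite -addrA addrCA ltrDr lt0r sqr_ge0 expf_neq0.
apply: (is_derive_eq (is_derive_mul (is_derive_const l^-1 s)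
  (is_derive_arctanh dc c1))).
have Wm : root_W s ^+ 2 - root_m ^+ 2 = lin_w s ^+ 2 by rewrite W2 m2; ring.
have -> : 1 - (root_m / root_W s) ^+ 2 = lin_w s ^+ 2 / root_W s ^+ 2.
  by rewrite -Wm; field.
by field; rewrite W0 w0 l0.
Qed.

End CanonicalCurve.

(** * Frenet data satisfying the rectifying and whirl conditions *)

Section WhirlRectifying.
Context {R : realType}.
(** The data are abstract so that [p] can be a translate of the given curve while the frame remains
    that of the curve itself. *)
Variables (I : set R) (p t n : R -> 'rV[R]_3) (kappa tau : R -> R).
Hypotheses (I_open : open I) (I_itv : is_interval I).
Let b s := crossv (t s) (n s).
Hypotheses (dp : forall s, I s -> is_derive s 1 p (t s))
  (dt : forall s, I s -> is_derive s 1 t (kappa s *: n s))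
  (dn : forall s, I s -> is_derive s 1 n (- kappa s *: t s + tau s *: b s))
  (db : forall s, I s -> is_derive s 1 b (- tau s *: n s)).
Hypotheses (tt : forall s, I s -> dotv (t s) (t s) = 1)
  (nn : forall s, I s -> dotv (n s) (n s) = 1)
  (tn : forall s, I s -> dotv (t s) (n s) = 0).
Hypotheses (kappa0 : forall s, I s -> kappa s != 0)
  (tau0 : forall s, I s -> tau s != 0).
Hypothesis pn : forall s, I s -> dotv (p s) (n s) = 0.
Implicit Types s : R.

(** As [p] is orthogonal to [n], [dotv p t] has derivative 1 and [dotv p b] has derivative 0.
    Differentiating [dotv p n = 0] then yields [tau * mu = kappa * (s + k)]. *)
Lemma rectifying_linear s0 : I s0 -> exists a c : R, a != 0 /\
  forall s, I s -> [/\ lin_w a c s != 0, dotv (p s) (t s) = lin_w a c s / a,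
    dotv (p s) (b s) = a^-1 & tau s = kappa s * lin_w a c s].
Proof.
move=> I0.
have dpt s : I s -> is_derive s 1 (fun x => dotv (p x) (t x)) 1.
  move=> Is; apply: (is_derive_eq (is_derive_dotv (dp Is) (dt Is))).
  by rewrite tt // dotvZr pn // mulr0 addr0.
have dpb s : I s -> is_derive s 1 (fun x => dotv (p x) (b x)) 0.
  move=> Is; apply: (is_derive_eq (is_derive_dotv (dp Is) (db Is))).
  by rewrite (frame_dotv (tt Is) (nn Is) (tn Is)) dotvZr pn // mulr0 addr0.
pose mu := dotv (p s0) (b s0); pose k := dotv (p s0) (t s0) - s0.
have pb s : I s -> dotv (p s) (b s) = mu.
  by move=> Is; exact: (is_derive0_cst_itv I_itv dpb).
have pt s : I s -> dotv (p s) (t s) = s + k.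
  move=> Is; have dk x : I x -> is_derive x 1 (fun x => dotv (p x) (t x) - x) 0.
    move=> Ix; apply: (is_derive_eq (is_derive_add (dpt x Ix)
      (is_derive_opp (is_derive_id x 1)))).
    by rewrite subrr.
  by rewrite /k -(is_derive0_cst_itv I_itv dk Is I0) addrC subrK.
have e s : I s -> tau s * mu = kappa s * (s + k).
  move=> Is; have := is_derive_unique (is_derive_on I_open Is pn
    (is_derive_dotv (dp Is) (dn Is))) (is_derive_const 0 s).
  rewrite tn // dotvDr !dotvZr pt // pb // add0r mulNr addrC => /eqP.
  by rewrite subr_eq0 => /eqP.
(* If [mu] vanished, so would [dotv p t] on all of [I], against its derivative 1. *)
have mu0 : mu != 0.
  apply/eqP => mu0; have pt0 s : I s -> dotv (p s) (t s) = 0.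
    move=> Is; rewrite pt //; have /eqP := e s Is.
    by rewrite mu0 mulr0 eq_sym mulf_eq0 (negPf (kappa0 Is)) => /eqP.
  have := is_derive_unique (is_derive_on I_open I0 pt0 (dpt s0 I0))
    (is_derive_const 0 s0).
  by apply/eqP/oner_neq0.
(* This makes [w] equal to [(s + k) / mu], so [e] becomes [tau = kappa * w]; [w] is nonzero because
   [tau] is. *)
exists mu^-1, (k / mu); split=> [|s Is]; first by rewrite invr_eq0.
have tauE : tau s = kappa s * lin_w mu^-1 (k / mu) s.
  have -> : tau s = tau s * mu / mu by field.
  by rewrite e // /lin_w; field.
split=> //.
- by apply: contra_neq (tau0 Is) => w0; rewrite tauE w0 mulr0.
- by rewrite pt // /lin_w; field.
- by rewrite pb // invrK.
Qed.

Variables (a c l : R).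
Hypotheses (a0 : a != 0) (l0 : l != 0).
Local Notation w := (lin_w a c).
Local Notation W := (root_W a c l).
Local Notation m := (root_m l).
Hypotheses (w0 : forall s, I s -> w s != 0)
  (pt : forall s, I s -> dotv (p s) (t s) = w s / a)
  (pb : forall s, I s -> dotv (p s) (b s) = a^-1)
  (tauE : forall s, I s -> tau s = kappa s * w s).

Let m0 : m != 0. Proof. exact: lt0r_neq0 (root_m_gt0 l). Qed.
Let W0 s : W s != 0. Proof. exact: lt0r_neq0 (root_W_gt0 a c l s). Qed.
Let W2 s : W s ^+ 2 = m ^+ 2 + w s ^+ 2.
Proof. by rewrite root_W2 root_m2; ring. Qed.

(** * Components of the whirl axis in the Frenet frame *)

Section Axis.
Variable d : 'rV[R]_3.
Hypotheses (dd : dotv d d = 1)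
  (nd : forall s, I s -> dotv (n s) d = l * dotv (t s) d).
Let T s := dotv (t s) d.
Let B s := dotv (b s) d.

Lemma is_derive_axis_tangent s : I s -> is_derive s 1 T (kappa s * (l * T s)).
Proof.
move=> Is.
apply: (is_derive_eq (is_derive_dotv (dt Is) (is_derive_vconst d s))).
by rewrite dotvZl nd // dotv0r addr0.
Qed.

(** Differentiate [dotv n d = l * T]: this gives [- kappa * T + tau * B = l ^+ 2 * kappa * T], where
    [tau = kappa * w] lets [kappa] cancel. *)
Lemma axis_binormal s : I s -> w s * B s = m ^+ 2 * T s.
Proof.
move=> Is; apply: (mulfI (kappa0 Is)).
have h1 := is_derive_dotv (dn Is) (is_derive_vconst d s).
have h2 := is_derive_mul (is_derive_const l s) (is_derive_axis_tangent Is).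
have := is_derive_unique (is_derive_on I_open Is nd h1) h2.
rewrite dotvDl !dotvZl dotv0r tauE // root_m2 -/(T s) -/(B s).
move: (kappa s) (T s) (B s) => k x y e.
transitivity (- k * x + k * w s * y + 0 + k * x); first by ring.
by rewrite e; ring.
Qed.

(** Parseval for the unit vector [d], multiplied by [w ^+ 2] so that [axis_binormal] eliminates
    [B]. *)
Lemma axis_unit s : I s -> T s ^+ 2 * (m ^+ 2 * W s ^+ 2) = w s ^+ 2.
Proof.
move=> Is; have e := frame_parseval (tt Is) (nn Is) (tn Is) d d.
have wB := axis_binormal Is.
rewrite dd !(dotvC d) nd // -/(b s) -/(T s) -/(B s) in e.
rewrite -[RHS]mulr1 e W2 mulrDr !mulrDr.
have -> : w s ^+ 2 * (B s * B s) = (m ^+ 2 * T s) ^+ 2 by rewrite -wB; ring.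
by rewrite root_m2; ring.
Qed.

(* Obtained by differentiating axis_unit. *)
Lemma whirl_rectifying_curvature s : I s ->
  kappa s * (l * w s * W s ^+ 2) = a * m ^+ 2.
Proof.
move=> Is; have dT := is_derive_axis_tangent Is.
have h1 := is_derive_mul (is_derive_sqr dT) (is_derive_mul
  (is_derive_const (m ^+ 2) s) (is_derive_sqr (is_derive_root_W a c l s))).
have := is_derive_unique (is_derive_on I_open Is axis_unit h1)
  (is_derive_sqr (is_derive_lin_w a c s)).
have e := axis_unit Is.
move: e (w0 Is) (W0 s) (W2 s); move: (T s) (w s) (W s) (kappa s) => x y z k.
move=> e y0 z0 z2 h.
have xz : x ^+ 2 * m ^+ 2 = y ^+ 2 / z ^+ 2 by rewrite -e; field.
(* Half the derivative of [axis_unit], with [T] eliminated by [axis_unit] itself. *)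
have h' : k * l * y ^+ 2 + y ^+ 3 * a / z ^+ 2 = y * a.
  apply: (mulfI (_ : 2 != 0 :> R)); first by rewrite pnatr_eq0.
  rewrite [RHS]mulrA -h -e.
  rewrite (_ : y ^+ 3 * a / z ^+ 2 = x ^+ 2 * m ^+ 2 * (y * a)); last first.
    by rewrite xz; field.
  by field.
apply: (mulfI y0).
have -> : y * (a * m ^+ 2) = z ^+ 2 * (y * a) - y ^+ 3 * a by rewrite z2; ring.
by rewrite -h'; field.
Qed.

(** Multiplied by [W], the derivative consists of two terms [a * m ^+ 2 * T] of opposite sign.
    Constancy of [B * W] fixes its sign on the whole of [I]. *)
Lemma is_derive_axis_binormal s : I s -> is_derive s 1 (fun x => B x * W x) 0.
Proof.
move=> Is; have dB := is_derive_dotv (db Is) (is_derive_vconst d s).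
apply: (is_derive_eq (is_derive_mul dB (is_derive_root_W a c l s))).
rewrite dotv0r dotvZl nd // tauE // -/(T s) -/(B s).
have wB := axis_binormal Is; have K := whirl_rectifying_curvature Is.
apply: (mulIf (W0 s)); rewrite mul0r.
transitivity (a * (w s * B s) - kappa s * (l * w s * W s ^+ 2) * T s).
  by move: (T s) (B s) (W0 s) => x y Ws0; field.
by rewrite wB K; ring.
Qed.

Lemma axis_binormal_unit s : I s -> (B s * W s) ^+ 2 = m ^+ 2.
Proof.
move=> Is; have w2 : w s ^+ 2 != 0 by rewrite expf_neq0 ?w0.
apply: (mulfI w2); rewrite exprMn mulrA -exprMn axis_binormal // mulrC.
by rewrite -axis_unit //; ring.
Qed.
End Axis.

Lemma whirl_axis_up s0 d : I s0 -> dotv d d = 1 ->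
  (forall s, I s -> dotv (n s) d = l * dotv (t s) d) ->
  exists d', [/\ dotv d' d' = 1,
    forall s, I s -> dotv (n s) d' = l * dotv (t s) d'
    & forall s, I s -> dotv (b s) d' * W s = m].
Proof.
move=> I0 dd nd; pose q := dotv (b s0) d * W s0.
have q2 : q ^+ 2 = m ^+ 2 by exact: axis_binormal_unit.
(* The factor [q / m] squares to 1, so this is [d] or its opposite. *)
exists ((q / m) *: d); split=> [|s Is|s Is].
- by rewrite dotvZl dotvZr dd mulr1 -expr2 expr_div_n q2 mulfV // expf_neq0.
- by rewrite !dotvZr nd //; ring.
- rewrite dotvZr -mulrA.
  rewrite (is_derive0_cst_itv I_itv (is_derive_axis_binormal dd nd) Is I0) -/q.
  by rewrite mulrAC -expr2 q2; field.
Qed.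

(** * Cartesian coordinates adapted to the axis *)

Section Coordinates.
Variable d : 'rV[R]_3.
Hypotheses (dd : dotv d d = 1)
  (nd : forall s, I s -> dotv (n s) d = l * dotv (t s) d)
  (bd : forall s, I s -> dotv (b s) d * W s = m).
Let theta := angle a c l.
Let u s := m^-1 *: (l *: t s - n s).
Let v s := crossv d (u s).
Let e1 s := cos (theta s) *: u s + sin (theta s) *: v s.

Let axis_bE s : I s -> dotv (b s) d = m / W s.
Proof. by move=> Is; rewrite -(bd Is) mulfK. Qed.

Let axis_tE s : I s -> dotv (t s) d = w s / (m * W s).
Proof.
move=> Is; have e := axis_binormal nd Is; rewrite axis_bE // in e.
have -> : dotv (t s) d = m ^+ 2 * dotv (t s) d / m ^+ 2 by field.
by rewrite -e; field; rewrite m0 W0.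
Qed.

Let vE s : I s -> v s = (W s)^-1 *: (t s + l *: n s - w s *: b s).
Proof.
move=> Is; have e := frame_crossv (tt Is) (nn Is) (tn Is).
rewrite /v {1}(frame_expand (tt Is) (nn Is) (tn Is) d) /u -/(b s).
rewrite !(dotvC d) nd // axis_tE // axis_bE //.
rewrite !(crossvDl, crossvZl, crossvDr, crossvZr, crossvNr) !e.
rewrite -![crossv (t s) (n s)]/(b s); move: (t s) (n s) (b s) => x y z.
apply/rowP => j; rewrite !mxE; move: (x 0 j) (y 0 j) (z 0 j) => {}x {}y {}z.
apply/eqP; rewrite -subr_eq0; apply/eqP.
(* The two sides differ by a multiple of [m ^+ 2 - (1 + l ^+ 2)], which [field] cannot see to be
   zero. *)
transitivity (w s * z / (m ^+ 2 * W s) * (m ^+ 2 - (1 + l ^+ 2))).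
  by field; rewrite m0 W0.
by rewrite root_m2 subrr mulr0.
Qed.

Let dotv_axis_u s : I s -> dotv d (u s) = 0.
Proof.
by move=> Is; rewrite !(dotvZr, dotvDr, dotvNr) !(dotvC d) nd // subrr mulr0.
Qed.

Let dotv_u s : I s -> dotv (u s) (u s) = 1.
Proof.
move=> Is; rewrite !dotv_lin (dotvC (n s)) tn // tt // nn //.
transitivity ((1 + l ^+ 2) / m ^+ 2); first by field.
by rewrite root_m2 mulfV // -root_m2 expf_neq0.
Qed.

(** The curvature formula identifies the derivative of the closed-form angle with minus the speed at
    which [u] and [v] turn. *)
Let is_derive_theta s : I s ->
  is_derive s 1 theta (- (kappa s * W s / m)).
Proof.
move=> Is; apply: (is_derive_eq (is_derive_angle l0 (w0 Is))).
have K := whirl_rectifying_curvature dd nd Is.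
have -> : m * a = kappa s * (l * w s * W s ^+ 2) / m by rewrite K; field.
by field; rewrite l0 W0 m0 w0.
Qed.

(** By the Frenet equations [m *: u'] is [kappa *: (t + l *: n - w *: b)], a multiple of [v] by
    [vE]. *)
Let is_derive_u s : I s ->
  is_derive s 1 u ((kappa s * W s / m) *: v s).
Proof.
move=> Is; have dlt := is_derive_vscale (is_derive_const l s) (dt Is).
have du := is_derive_vscale (is_derive_const m^-1 s)
  (is_derive_vadd dlt (is_derive_vopp (dn Is))).
apply: (is_derive_eq du); rewrite vE // tauE //.
move: (t s) (n s) (b s) => x y z; apply/rowP => j; rewrite !mxE.
by field; rewrite m0 W0.
Qed.

(** Crossing twice with the unit vector [d] negates [u], which is orthogonal to [d]. *)
Let is_derive_v s : I s ->
  is_derive s 1 v (- (kappa s * W s / m) *: u s).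
Proof.
move=> Is.
apply: (is_derive_eq
  (is_derive_crossv (is_derive_vconst d s) (is_derive_u Is))).
rewrite crossvZr /v double_crossv dotv_axis_u // dd -(scale0r d) crossvZl.
by rewrite !scale0r add0r sub0r scale1r scalerN scaleNr.
Qed.

Let is_derive_e1 s : I s -> is_derive s 1 e1 0.
Proof.
move=> Is; have dth := is_derive_theta Is.
apply: (is_derive_eq (is_derive_vadd
  (is_derive_vscale (is_derive_comp_cos dth) (is_derive_u Is))
  (is_derive_vscale (is_derive_comp_sin dth) (is_derive_v Is)))).
by move: (u s) (v s) => x y; apply/rowP => j; rewrite !mxE; ring.
Qed.

(** In the orthonormal frame [u], [v], [d] the component of [p] along [v] vanishes. Turning [u] by
    [theta] gives the cosine; [crossv d v = - u] gives the minus sign of the sine. *)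
Lemma whirl_rectifying_coordinates s0 : I s0 -> exists e : 'rV[R]_3,
  [/\ dotv e e = 1, dotv d e = 0 & forall s, I s ->
   [/\ dotv (p s) e = w s / a * (l / m) * cos (theta s),
       dotv (p s) (crossv d e) = - (w s / a * (l / m) * sin (theta s))
     & dotv (p s) d = a^-1 * (W s / m)]].
Proof.
(* Any base point serves, since [e1] is constant on [I]. *)
move=> I0; exists (e1 s0).
have eE s : I s -> e1 s0 = e1 s.
  by move=> Is; apply: (is_derive0_vcst_itv I_itv is_derive_e1).
have uv s : dotv (v s) (u s) = 0 by exact: dotv_crossvr.
have dv s : dotv (v s) d = 0 by exact: dotv_crossvl.
have vv s : I s -> dotv (v s) (v s) = 1.
  move=> Is; rewrite dotv_crossv2 dd dotv_u // dotv_axis_u //.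
  by rewrite expr0n subr0 mulr1.
have pu s : I s -> dotv (p s) (u s) = w s / a * (l / m).
  move=> Is; rewrite !(dotvZr, dotvDr, dotvNr) pt // pn //.
  by field; rewrite a0 m0.
have pv s : I s -> dotv (p s) (v s) = 0.
  move=> Is; rewrite vE // !(dotvZr, dotvDr, dotvNr) pt // pn // pb //.
  by field; rewrite W0 a0.
split=> [||s Is].
- move: (uv s0) (dotv_u I0) (vv s0 I0); rewrite /e1.
  move: (u s0) (v s0) => x y xy xx yy.
  rewrite !dotv_lin xy (dotvC x) xy xx yy.
  by rewrite -[RHS](cos2Dsin2 (theta s0)); ring.
- move: (dotv_axis_u I0) (dv s0); rewrite /e1; move: (u s0) (v s0) => x y dx yd.
  by rewrite !dotv_lin dx (dotvC d) yd !mulr0 addr0.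
split.
- rewrite (eE s Is); move: (pu s Is) (pv s Is); rewrite /e1.
  by move: (u s) (v s) => x y px py; rewrite !dotv_lin px py; ring.
- rewrite (eE s Is); move: (pu s Is) (pv s Is) (dotv_axis_u Is).
  rewrite /e1 /v; move: (u s) => x px py dx.
  rewrite crossvDr !crossvZr double_crossv dx dd scale0r scale1r.
  by rewrite !dotv_lin px py dotv0r; ring.
- rewrite (frame_parseval (tt Is) (nn Is) (tn Is)) pt // pn // pb //.
  rewrite !(dotvC d) axis_tE // axis_bE //.
  apply: (mulIf (W0 s)); rewrite mul0r addr0.
  transitivity ((w s ^+ 2 + m ^+ 2) / (a * m)).
    by field; rewrite a0 m0 W0.
  by rewrite addrC -W2; field; rewrite a0 m0.
Qed.
End Coordinates.

End WhirlRectifying.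

(** * The explicit curve *)

Section Converse.
Context {R : realType}.
Variables (I : set R) (g : R -> 'rV[R]_3) (e : 'rV[R]_3) (a c l : R).
Hypotheses (I_open : open I) (g_frenet : frenet_curve I g).
Hypotheses (a0 : a != 0) (ee : dotv e e = 1).
Local Notation w := (lin_w a c).
Local Notation W := (root_W a c l).
Local Notation m := (root_m l).
Hypotheses (gg : forall s, I s -> dotv (g s) (g s) = (1 + w s ^+ 2) / a ^+ 2)
  (ge : forall s, I s -> dotv (g s) e = a^-1 * (W s / m)).
Implicit Types s : R.

Let m0 : m != 0. Proof. exact: lt0r_neq0 (root_m_gt0 l). Qed.
Let W0 s : W s != 0. Proof. exact: lt0r_neq0 (root_W_gt0 a c l s). Qed.
Let W2 s : W s ^+ 2 = m ^+ 2 + w s ^+ 2.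
Proof. by rewrite root_W2 root_m2; ring. Qed.

Lemma dotv_curve_tangent s : I s -> dotv (g s) (tangent g s) = w s / a.
Proof.
move=> Is; have dg := is_derive_curve g_frenet Is.
have h := is_derive_mul (is_derive_add (is_derive_const 1 s)
  (is_derive_sqr (is_derive_lin_w a c s))) (is_derive_const (a ^+ 2)^-1 s).
have := is_derive_unique (is_derive_on I_open Is gg (is_derive_dotv dg dg)) h.
rewrite (dotvC (tangent _ _)); move: (dotv _ _) => x xE.
apply: (mulfI (_ : 2 != 0 :> R)); first by rewrite pnatr_eq0.
transitivity (x + x); first by ring.
by rewrite xE; field.
Qed.

(** Differentiating [dotv g t = w / a] gives [1 + kappa * dotv g n = 1]. *)
Lemma dotv_curve_normal s : I s -> dotv (g s) (normal g s) = 0.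
Proof.
move=> Is; have dg := is_derive_curve g_frenet Is.
have h := is_derive_mul (is_derive_lin_w a c s) (is_derive_const a^-1 s).
have := is_derive_unique (is_derive_on I_open Is dotv_curve_tangent
  (is_derive_dotv dg (is_derive_tangent g_frenet Is))) h.
rewrite (dotv_tangent g_frenet Is) dotvZr; move: (dotv _ _) => x.
rewrite mulfV // mulr0 addr0 -[RHS]addr0 => /addrI /eqP.
by rewrite mulf_eq0 (negPf (curvature_neq0 g_frenet Is)) => /eqP.
Qed.

Lemma dotv_tangent_axis s : I s -> dotv (tangent g s) e = w s / (m * W s).
Proof.
move=> Is; have dge := is_derive_dotv (is_derive_curve g_frenet Is)
  (is_derive_vconst e s).
have h := is_derive_mul (is_derive_const a^-1 s) (is_derive_mul
  (is_derive_root_W a c l s) (is_derive_const m^-1 s)).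
have := is_derive_unique (is_derive_on I_open Is ge dge) h.
by rewrite dotv0r addr0 => ->; field; rewrite a0 m0 W0.
Qed.

(** The derivative of [dotv_tangent_axis]. The factor [kappa] is positive, so this determines the
    sign of [dotv n e]. *)
Lemma dotv_normal_axis s : I s ->
  curvature g s * dotv (normal g s) e = a * m / W s ^+ 3.
Proof.
move=> Is; have dte := is_derive_dotv (is_derive_tangent g_frenet Is)
  (is_derive_vconst e s).
have mW0 : m * W s != 0 by rewrite mulf_neq0.
have h := is_derive_mul (is_derive_lin_w a c s) (is_derive_inv (is_derive_mul
  (is_derive_const m s) (is_derive_root_W a c l s)) mW0).
have := is_derive_unique (is_derive_on I_open Is dotv_tangent_axis dte) h.
rewrite dotv0r addr0 dotvZl => ->.
transitivity (a * (W s ^+ 2 - w s ^+ 2) / (m * W s ^+ 3)).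
  by field; rewrite m0 W0.
by rewrite W2; field; rewrite m0 W0.
Qed.

(** Parseval for [dotv g g], [dotv g e] and [dotv e e] successively yields the square of
    [mu = dotv g b], the product of [mu] with [B = dotv b e], and the square of [N = dotv n e].
    Squares appear because the sign of [mu] is unknown. *)
Lemma dotv_normal_axis_sqr s : I s ->
  dotv (normal g s) e ^+ 2 = (l * dotv (tangent g s) e) ^+ 2.
Proof.
move=> Is.
have F := frame_parseval (dotv_tangent g_frenet Is) (dotv_normal g_frenet Is)
  (dotv_tangent_normal I_open g_frenet Is).
have := F (g s) (g s); have := F (g s) e; have := F e e.
rewrite gg // ge // ee dotv_curve_tangent // dotv_curve_normal // !(dotvC e).
move: (dotv_tangent_axis Is); move: (dotv (tangent g s) e) => T TE.
move: (dotv _ e) (dotv (crossv _ _) e) (dotv (g s) _) => N B mu eE geE ggE.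
have mu2 : mu ^+ 2 = (a ^+ 2)^-1.
  transitivity ((1 + w s ^+ 2) / a ^+ 2 - (w s / a) ^+ 2); last by field.
  by rewrite ggE; ring.
have muB : mu * B = m / (a * W s).
  transitivity (a^-1 * (W s / m) - w s / a * T); first by rewrite geE; ring.
  rewrite TE; transitivity ((W s ^+ 2 - w s ^+ 2) / (a * m * W s)).
    by field; rewrite a0 m0 W0.
  by rewrite W2; field; rewrite a0 m0 W0.
have B2 : B ^+ 2 = m ^+ 2 / W s ^+ 2.
  transitivity (a ^+ 2 * (mu * B) ^+ 2).
    by rewrite exprMn mu2; field.
  by rewrite muB; field; rewrite a0 W0.
have -> : N ^+ 2 = 1 - T ^+ 2 - B ^+ 2 by rewrite eE; ring.
have l2 : l ^+ 2 = m ^+ 2 - 1 by rewrite root_m2; ring.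
rewrite exprMn l2 B2 TE; transitivity ((W s ^+ 2 * m ^+ 2 - w s ^+ 2 - m ^+ 4)
  / (m ^+ 2 * W s ^+ 2)); first by field; rewrite m0 W0.
rewrite (_ : W s ^+ 2 * _ - _ - _ = (m ^+ 2 - 1) * w s ^+ 2).
  by field; rewrite m0 W0.
by rewrite W2; ring.
Qed.

(** Decides between the two square roots left open by [dotv_normal_axis_sqr]: [dotv n e] has the
    sign of [a] and [dotv t e] that of [w]. *)
Lemma dotv_normal_axis_sign s : I s -> w s != 0 -> l != 0 ->
  0 < l * a * w s * (dotv (normal g s) e * (l * dotv (tangent g s) e)).
Proof.
move=> Is w0 l0; have k0 := curvature_neq0 g_frenet Is.
have kp : 0 < curvature g s by case: g_frenet => _ _ ->.
have -> : dotv (normal g s) e = a * m / W s ^+ 3 / curvature g s.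
  by rewrite -dotv_normal_axis //; field.
rewrite dotv_tangent_axis //.
rewrite (_ : _ * _ = (l * a * w s) ^+ 2 / (W s ^+ 4 * curvature g s));
  last by field; rewrite m0 W0 k0.
apply: divr_gt0; last by rewrite mulr_gt0 ?exprn_gt0 ?root_W_gt0.
by rewrite lt0r sqr_ge0 andbT expf_neq0 // !mulf_neq0.
Qed.

Lemma dotv_normal_axis_pos s : I s -> w s != 0 -> l != 0 -> 0 < l * a * w s ->
  dotv (normal g s) e = l * dotv (tangent g s) e.
Proof.
move=> Is w0 l0 pos; have := dotv_normal_axis_sign Is w0 l0.
rewrite pmulr_rgt0 //; have /eqP := dotv_normal_axis_sqr Is.
rewrite eqf_sqr => /orP[/eqP //|/eqP ->]; rewrite mulNr -expr2 oppr_gt0.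
by rewrite ltNge sqr_ge0.
Qed.

Lemma dotv_normal_axis_neg s : I s -> w s != 0 -> l != 0 -> l * a * w s < 0 ->
  dotv (normal g s) e = - l * dotv (tangent g s) e.
Proof.
move=> Is w0 l0 neg; have := dotv_normal_axis_sign Is w0 l0.
rewrite nmulr_rgt0 //; have /eqP := dotv_normal_axis_sqr Is.
rewrite eqf_sqr => /orP[/eqP ->|/eqP -> _]; last by rewrite mulNr.
by rewrite -expr2 ltNge sqr_ge0.
Qed.
End Converse.

(** Between points where the signs are opposite lies the root [- b / a], which would then belong to
    [I]. *)
Lemma affine_constant_sign {R : realType} (I : set R) (a b : R) :
  is_interval I -> (forall s, I s -> a * s + b != 0) ->
  (forall s, I s -> 0 < a * s + b) \/ (forall s, I s -> a * s + b < 0).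
Proof.
move=> I_itv h; apply: contrapT => /not_orP[].
move=> /existsNP[x /not_implyP[Ix /negP]] + /existsNP[y /not_implyP[Iy /negP]].
rewrite -!leNgt !le_eqVlt (negPf (h x Ix)) eq_sym (negPf (h y Iy)) /= => hx hy.
have a0 : a != 0 by apply/eqP => a0; move: hx hy; rewrite a0 !mul0r; lra.
have Iz : I (- b / a).
  case: (ltgtP a 0) a0 => [a0 _|a0 _|//].
    apply: (I_itv y x) => //; apply/andP; split.
      by rewrite ler_ndivlMr //; lra.
    by rewrite ler_ndivrMr //; lra.
  apply: (I_itv x y) => //; apply/andP; split.
    by rewrite ler_pdivlMr //; lra.
  by rewrite ler_pdivrMr //; lra.
by move: (h _ Iz); rewrite mulrC divfK // addNr eqxx.
Qed.

(** Convertible with the explicit curve of the final statement. *)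
Definition canonical_curve {R : realType} (a b l s : R) : 'rV[R]_3 :=
  row3 (lin_w a b s / a * (l / root_m l) * cos (angle a b l s))
    (- (lin_w a b s / a * (l / root_m l) * sin (angle a b l s)))
    (a^-1 * (root_W a b l s / root_m l)).

Lemma congruent_refl {R : realType} (I : set R) (g : R -> 'rV[R]_3) :
  congruent I g g.
Proof.
exists id => //; exists 1%:M, 0; split; rewrite ?trmx1 ?mulmx1 ?det1 //.
by move=> p; rewrite mulmx1 addr0.
Qed.

(** * Classification up to rigid motion *)

Section Classification.
Context {R : realType}.
Variables (I : set R) (sigma : R -> 'rV[R]_3).
Hypotheses (I_open : open I) (sigma_frenet : frenet_curve I sigma)
  (sigma_torsion : forall s, I s -> torsion sigma s != 0).

(** The whirl condition involves directions only, so an axis of the image is pulled back by [A^T],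
    the inverse of [A]. *)
Lemma whirl_congruentP :
  (exists2 g, whirl_curve I g & congruent I sigma g) <-> whirl_curve I sigma.
Proof.
split=> [[g [_ _ [d [l [d1 l0 nd]]]] [f [A [v [AA _ fE]]] fg]]|]; last first.
  by move=> h; exists sigma => //; exact: congruent_refl.
have gE s : I s -> sigma s *m A + v = g s by move=> Is; rewrite -fE fg.
split=> //; exists (d *m A^T), l; split=> // [|s Is].
  by rewrite enorm_orthogonal // trmxK mulmx1C.
rewrite -!dotv_mulmxl -(normal_motion I_open sigma_frenet AA gE Is).
by rewrite -(tangent_motion I_open sigma_frenet gE Is) nd.
Qed.

(** Inner products absorb the rotation, but the condition depends on the origin, so a translation
    survives. *)
Lemma rectifying_congruentP :
  (exists2 g, rectifying_curve I g & congruent I sigma g) <->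
  exists v, forall s, I s -> dotv (sigma s + v) (normal sigma s) = 0.
Proof.
split=> [[g [_ gn] [f [A [v [AA _ fE]]] fg]]|[v vn]].
  have gE s : I s -> sigma s *m A + v = g s by move=> Is; rewrite -fE fg.
  exists (v *m A^T) => s Is.
  move: (gn s Is).
  rewrite (normal_motion I_open sigma_frenet AA gE Is) -(gE s Is).
  move: (normal _ _) => n; rewrite !dotvDl (dotv_orthogonal _ _ AA) => <-.
  by rewrite (dotv_mulmxl _ v) trmxK.
(* A translation is treated as a rigid motion with identity matrix, to reuse the transport
   lemmas. *)
have gE s : I s -> sigma s *m 1%:M + v = sigma s + v by rewrite mulmx1.
have A1 : 1%:M *m (1%:M : 'M[R]_3)^T = 1%:M by rewrite trmx1 mulmx1.
exists (fun s => sigma s + v).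
  split=> [|s Is]; first exact: frenet_motion I_open sigma_frenet A1 gE.
  by rewrite (normal_motion I_open sigma_frenet A1 gE Is) mulmx1; exact: vn.
exists (fun p => p + v) => //; exists 1%:M, v.
split=> //; first by rewrite det1.
by move=> p; rewrite mulmx1.
Qed.

Hypothesis I_itv : is_interval I.
Hypothesis curvature_diff : forall s, I s -> derivable (curvature sigma) s 1.

Lemma whirl_rectifying_canonical v : I !=set0 -> whirl_curve I sigma ->
  (forall s, I s -> dotv (sigma s + v) (normal sigma s) = 0) ->
  exists l a b : R,
    [/\ l != 0, a != 0,
        (forall s, I s -> 0 < a * s + b) \/ (forall s, I s -> a * s + b < 0)
      & congruent I sigma (canonical_curve a b l)].
Proof.
move=> [s0 I0] [_ _ [d [l [/enorm1P dd l0 nd]]]] pn.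
pose p s := sigma s + v.
have dp s : I s -> is_derive s 1 p (tangent sigma s).
  move=> Is; have ds := is_derive_curve sigma_frenet Is.
  apply: (is_derive_eq (is_derive_vadd ds (is_derive_vconst v s))).
  by rewrite addr0.
have dt := @is_derive_tangent _ _ _ sigma_frenet.
have dn := is_derive_normal I_open sigma_frenet curvature_diff.
have db := is_derive_binormal I_open sigma_frenet curvature_diff.
have tt := @dotv_tangent _ _ _ sigma_frenet.
have nn := @dotv_normal _ _ _ sigma_frenet.
have tn := @dotv_tangent_normal _ _ _ I_open sigma_frenet.
have k0 := @curvature_neq0 _ _ _ sigma_frenet.
have [a [b [a0 H]]] :=
  rectifying_linear I_open I_itv dp dt dn db tt nn tn k0 sigma_torsion pn I0.
have w0 s : I s -> lin_w a b s != 0 by case/H.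
have pt s : I s -> dotv (p s) (tangent sigma s) = lin_w a b s / a by case/H.
have pb s : I s -> dotv (p s) (binormal sigma s) = a^-1 by case/H.
have tauE s : I s -> torsion sigma s = curvature sigma s * lin_w a b s.
  by case/H.
have [d' [dd' nd' bd']] := whirl_axis_up I_open I_itv dt dn db tt nn tn k0
  w0 tauE I0 dd nd.
have [e [ee de H']] := whirl_rectifying_coordinates I_open I_itv dt dn tt nn
  tn k0 pn a0 l0 w0 pt pb tauE dd' nd' bd' I0.
exists l, a, b; split=> //.
  by apply: affine_constant_sign => // s Is; rewrite addrC w0.
pose f := crossv d' e.
have ff : dotv f f = 1 by rewrite dotv_crossv2 dd' ee de; ring.
have ef : dotv e f = 0 by rewrite dotvC dotv_crossvr.
have efd : crossv e f = d'.
  by rewrite double_crossv ee (dotvC e) de scale1r scale0r subr0.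
(* This motion sends [x] to the coordinates of [x + v] in the oriented orthonormal basis [e], [f],
   [d']. *)
exists (fun x => x *m (frame_mx e f)^T + v *m (frame_mx e f)^T).
  exists (frame_mx e f)^T, (v *m (frame_mx e f)^T); split=> //.
    by rewrite trmxK mulmx1C // frame_mx_orthogonal.
  by rewrite det_tr det_frame_mx.
move=> s Is; rewrite -mulmxDl mulmx_trframe efd.
by have [-> -> ->] := H' s Is.
Qed.

Lemma canonical_whirl_rectifying l a b : l != 0 -> a != 0 ->
  (forall s, I s -> 0 < a * s + b) \/ (forall s, I s -> a * s + b < 0) ->
  congruent I sigma (canonical_curve a b l) ->
  whirl_curve I sigma /\
  exists v, forall s, I s -> dotv (sigma s + v) (normal sigma s) = 0.
Proof.
move=> l0 a0 sgn [f [A [v [AA detA fE]]] fg]; pose g s := f (sigma s).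
(* On [I] the curve [g] is the explicit one, but its Frenet regularity is inherited from [sigma]
   instead of being computed. *)
have gE s : I s -> sigma s *m A + v = g s by rewrite /g fE.
have g_frenet := frenet_motion I_open sigma_frenet AA gE.
pose e : 'rV[R]_3 := row3 0 0 1.
have ee : dotv e e = 1 by rewrite dotvE !row3E; ring.
have m0 : root_m l != 0 by exact: lt0r_neq0 (root_m_gt0 l).
have ge s : I s -> dotv (g s) e = a^-1 * (root_W a b l s / root_m l).
  by move=> Is; rewrite /g fg // dotvE !row3E; ring.
have gg s : I s -> dotv (g s) (g s) = (1 + lin_w a b s ^+ 2) / a ^+ 2.
  move=> Is; rewrite /g fg // dotvE !row3E.
  move: (root_W2 a b l s) (root_m2 l) m0 (cos2Dsin2 (angle a b l s)).
  move: (cos _) (sin _) (root_W _ _ _ _) (root_m _) (lin_w _ _ _) => C S W m w.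
  move=> W2 m2 m0 CS.
  (* The numerator reduces to [w ^+ 2 * l ^+ 2 + W ^+ 2], which factors as
     [(1 + w ^+ 2) * m ^+ 2]. *)
  transitivity ((w ^+ 2 * l ^+ 2 * (C ^+ 2 + S ^+ 2) + W ^+ 2)
    / (a ^+ 2 * m ^+ 2)).
    by field; rewrite a0 m0.
  rewrite CS W2 (_ : _ + _ = (1 + w ^+ 2) * m ^+ 2); last by rewrite m2; ring.
  by field; rewrite a0 m0.
have w0 s : I s -> lin_w a b s != 0.
  rewrite /lin_w addrC => Is; case: sgn => /(_ s Is).
    exact: lt0r_neq0.
  exact: ltr0_neq0.
have nE s := normal_motion I_open sigma_frenet AA gE (s := s).
have tE s := tangent_motion I_open sigma_frenet gE (s := s).
split; last first.
  apply/rectifying_congruentP; exists g; last first.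
    by exists f => //; exists A, v; split.
  by split=> // s Is; apply: dotv_curve_normal I_open g_frenet a0 gg _ Is.
(* This uniform sign selects one whirl constant, [l] or [- l], for the whole interval. *)
have : (forall s, I s -> 0 < l * a * lin_w a b s) \/
       (forall s, I s -> l * a * lin_w a b s < 0).
  have la0 : l * a != 0 by rewrite mulf_neq0.
  rewrite /lin_w; case: sgn => h; case: (ltgtP (l * a) 0) la0 => // la _.
  - by right=> s Is; rewrite nmulr_rlt0 // addrC h.
  - by left=> s Is; rewrite pmulr_rgt0 // addrC h.
  - by left=> s Is; rewrite nmulr_rgt0 // addrC h.
  - by right=> s Is; rewrite pmulr_rlt0 // addrC h.
move=> sgn'; split=> //; exists (e *m A^T).
have e1 : enorm (e *m A^T) = 1.
  have AA' : A^T *m A^T^T = 1%:M by rewrite trmxK; exact: mulmx1C.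
  by rewrite (enorm_orthogonal e AA'); apply/enorm1P.
case: sgn' => h; [exists l | exists (- l)]; split; rewrite ?oppr_eq0 // => s Is.
- rewrite -!dotv_mulmxl -nE // -tE //.
  exact: dotv_normal_axis_pos I_open g_frenet a0 ee gg ge _ Is (w0 s Is) l0
    (h s Is).
- rewrite -!dotv_mulmxl -nE // -tE //.
  exact: dotv_normal_axis_neg I_open g_frenet a0 ee gg ge _ Is (w0 s Is) l0
    (h s Is).
Qed.

End Classification.

Theorem theorem3p2 (R : realType) (I : set R) (sigma : R -> 'rV[R]_3)
  (I_open : open I) (I_itv : is_interval I)
  (sigma_frenet : frenet_curve I sigma)
  (sigma_torsion : forall s, I s -> torsion sigma s != 0)
  (curvature_diff : forall s, I s -> derivable (curvature sigma) s 1)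
  (torsion_diff : forall s, I s -> derivable (torsion sigma) s 1) :
  ((exists2 g, whirl_curve I g & congruent I sigma g) /\
   (exists2 g, rectifying_curve I g & congruent I sigma g))
  <->
  (exists lambda a b : R,
    [/\ lambda != 0, a != 0,
        (forall s, I s -> 0 < a * s + b) \/ (forall s, I s -> a * s + b < 0)
      & congruent I sigma (fun s =>
          let w := b + a * s in
          let theta := lambda^-1 *
            arctanh (Num.sqrt
              ((1 + lambda ^+ 2) / (1 + w ^+ 2 + lambda ^+ 2))) in
          row3
            (w / a * (lambda / Num.sqrt (1 + lambda ^+ 2)) * cos theta)
            (- (w / a * (lambda / Num.sqrt (1 + lambda ^+ 2)) * sin theta))
            (a^-1 * (Num.sqrt (1 + w ^+ 2 + lambda ^+ 2)
                     / Num.sqrt (1 + lambda ^+ 2))))]).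
Proof.
split.
  move=> [/(whirl_congruentP I_open sigma_frenet sigma_torsion) sigma_whirl].
  move=> /(rectifying_congruentP I_open sigma_frenet)[v vn].
  have [-> | I0] := eqVneq I set0.
    (* Over the empty set the pointwise conditions are vacuous; only nonzero values for [lambda] and
       [a] are required. *)
    exists 1, 1, 0; split; rewrite ?oner_eq0 //; first by left.
    exists id => //; exists 1%:M, 0; split; rewrite ?trmx1 ?mulmx1 ?det1 //.
    by move=> p; rewrite mulmx1 addr0.
  move/set0P in I0.
  exact: (whirl_rectifying_canonical I_open sigma_frenet sigma_torsion I_itv
    curvature_diff I0 sigma_whirl vn).
move=> [l [a [b [l0 a0 sgn sigmaE]]]].
have [? ?] := canonical_whirl_rectifying I_open sigma_frenet sigma_torsion l0 a0
  sgn sigmaE.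
by split; [exact/whirl_congruentP | exact/rectifying_congruentP].
Qed.
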